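(* Let $q\ge2$ be an integer and $0<p<\frac{q-1}q$. There are constants $c>0$ and $c'>0$ depending only on $p,q$ such that the following holds for every positive integer $n$ for which $pn$ is an integer and every positive integer $k$. Consider $X=\{0,1,\ldots,q-1\}^n$ endowed with the Hamming distance $\Delta$. (1) $(X,\Delta)$ has exponential growth at radius $pn$ with rate $c$. (2) $(X,\Delta)$ is $(pn,k)$-dispersed with constant $\alpha=\frac12\left(1-\frac{pq}{q-1}\right)>0$. (3) For any $a,b\in X$ with $\Delta(a,b)=k$ and any integer $i$ with $0\le i\le\alpha k$, $\ell_{a,b}(\mathbf x)-\mathbb E\,\ell_{a,b}(\mathbf x)$ is $400k$-subgaussian, where $\mathbf x$ is drawn uniformly from $S(a,pn-i)$. Consequently, for every $a,b\in X$, $$\frac{|B(a,pn)\cap B(b,pn)|}{|B(a,pn)|}\le2e^{-c'\Delta(a,b)}.$$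
   Context: The Hamming distance $\Delta(x,y)$ is the number of coordinates in which $x,y$ differ. $B(a,s)=\{x\in X:\Delta(x,a)\le s\}$, $S(a,s)=\{x\in X:\Delta(x,a)=s\}$, and $\ell_{a,b}(x)=\Delta(x,b)-\Delta(x,a)$. Exponential growth at radius $r$ with rate $c$: for every $a\in X$ and every integer $t$ with $0\le t<r$, $|B(a,r-t)|\le2e^{-ct}|B(a,r)|$. $(r,k)$-dispersed with constant $\alpha$: for any $a,b\in X$ at distance exactly $k$ and any integer $i$ with $0\le i\le\alpha k$, $\mathbb E_{\mathbf x\sim S(a,r-i)}[\ell_{a,b}(\mathbf x)]\ge2\alpha k$, with $\mathbf x$ uniform on $S(a,r-i)$. A real random variable $\mathbf Y$ is $K$-subgaussian if $\mathbb P(|\mathbf Y|\ge t)\le2\exp(-t^2/K)$ for all $t\ge0$. Convention: conditions on a uniform random point of $S(a,r-i)$ are vacuous when $S(a,r-i)$ is empty. *)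

(* Defs.v *)
From HB Require Import structures.
From mathcomp Require Import all_boot all_order all_algebra.
From mathcomp Require Import reals sequences.

Set Implicit Arguments.
Unset Strict Implicit.
Unset Printing Implicit Defensive.

Import Order.TTheory GRing.Theory Num.Theory.
Local Open Scope ring_scope.

Section Uniform.
Variables (R : realType) (T : finType).

(* For [x] uniform on a finite set [A]; both have the junk value 0 when
   [A] is empty, so the statements using them assume [A != set0]. *)
Definition uexp (A : {set T}) (f : T -> R) : R :=
  (\sum_(x in A) f x) / #|A|%:R.

Definition uprob (A : {set T}) (P : pred T) : R :=
  #|[set x in A | P x]|%:R / #|A|%:R.

Definition usubgaussian (A : {set T}) (Y : T -> R) (K : R) : Prop :=
  forall t : R, 0 <= t ->
    uprob A (fun x => t <= `|Y x|) <= 2 * expR (- (t ^+ 2 / K)).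

End Uniform.

Section FiniteMetric.
Variables (R : realType) (T : finType) (d : T -> T -> nat).

(* Radii are real: truncated subtraction on [nat] would turn the empty sphere
   of radius [r - i < 0] into the singleton of radius 0. *)
Definition mball (a : T) (s : R) : {set T} := [set x | (d x a)%:R <= s].

Definition msphere (a : T) (s : R) : {set T} := [set x | (d x a)%:R == s].

Definition ell (a b x : T) : R := (d x b)%:R - (d x a)%:R.

Definition exp_growth (r c : R) : Prop :=
  forall (a : T) (t : nat), t%:R < r ->
    #|mball a (r - t%:R)|%:R <= 2 * expR (- (c * t%:R)) * #|mball a r|%:R.

Definition dispersed (r : R) (k : nat) (alpha : R) : Prop :=
  forall a b : T, d a b = k ->
  forall i : nat, i%:R <= alpha * k%:R ->
    msphere a (r - i%:R) != set0 ->
    2 * alpha * k%:R <= uexp (msphere a (r - i%:R)) (ell a b).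

End FiniteMetric.

Definition word (q n : nat) : finType := {ffun 'I_n -> 'I_q}.

Definition hamming (q n : nat) (x y : word q n) : nat :=
  #|[set j : 'I_n | x j != y j]|.

(* Main.v *)
Require Import Defs.
From HB Require Import structures.
From mathcomp Require Import all_boot all_order all_algebra.
From mathcomp Require Import reals sequences exp.
From mathcomp Require Import ring lra zify.

Set Implicit Arguments.
Unset Strict Implicit.
Unset Printing Implicit Defensive.

Import Order.TTheory GRing.Theory Num.Theory.
Local Open Scope ring_scope.

(** Write q = m + 1.  Seen from a, a word x is described coordinate by
    coordinate, so a sum over the sphere of radius s around a of a product of
    letter weights is the coefficient of 'X^s in a product of linear
    polynomials in which 'X marks the coordinates where x leaves a
    ([sum_nsphere_prod]).  All the information on spheres that is needed is
    read off such coefficients: with trivial weights each coordinate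
    contributes 1 + m 'X and the sphere has C(n, s) m^s points
    ([card_nsphere]).

    Growth: the ratio of the sizes of the spheres of radii s and s + 1 is
    (s + 1) / ((n - s) m), which for s < pn is at most rho = p / ((1 - p) m),
    and rho < 1 exactly because p < (q - 1) / q.  Shifting the sum of the
    sphere sizes by t gives exponential growth with rate c = - ln rho
    ([nball_growth]), even with constant 1 in place of 2.

    Dispersion: let k be the distance from a to b.  Each of the k coordinates
    where a and b differ contributes +1, -1 or 0 to ell according to whether
    x agrees with a, with b, or with neither; its mean is
    1 - (s / n) (q / m), the [drift], which is at least 2 alpha for s <= pn
    ([sum_nsphere_ell], [drift_radius_le]).

    Concentration: the k contributions are those of a sampling without
    replacement, hence dependent.  The moment generating function of ell is
    the coefficient of 'X^s in a product of k tilted factors and n - k plain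
    ones.  Removing one tilted factor conditions on one coordinate, which
    lands in the sphere of radius s or s - 1 in dimension n - 1.  The change
    of drift caused by this conditioning is absorbed in the value of the
    revealed coordinate, turning it into a centred variable with three values
    in [-2, 2].  So each step costs a factor of at most exp (8 l^2)
    ([mgf_step], [tilted_coef_le]), and the Chernoff bound yields one-sided
    tails exp (- t^2 / (32 k)) ([nsphere_tail]), well within 400 k.

    Intersection of two balls: a point of both balls lies either more than
    alpha k below the boundary of the ball around a, which is rare by growth,
    or on a sphere of radius s >= pn - alpha k, where ell <= alpha k falls
    short of its mean by at least alpha k, which is rare by concentration
    ([nball_inter_le]).  Since both estimates hold with constant 1, their sum
    has the constant 2, for c' the smaller of the two rates c alpha and
    alpha^2 / 32. *)

(** * Exponential moments of bounded centred variables *)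

Section ExponentialBounds.
Variable R : realType.

(** The missing constant term 1 is what makes this useful: averaging over a
    centred y kills the linear term and leaves a pure Gaussian bound.  For
    y <= 1/2 it follows from exp y <= 1 / (1 - y) <= 1 + y + 2 y^2, and for
    y > 1/2 from y <= 2 y^2. *)
Lemma expR_le_add_expR_sqr (y : R) : expR y <= y + expR (2 * y ^+ 2).
Proof.
have [y_small|y_large] := lerP y (1 / 2).
- have sqr_le : 1 + 2 * y ^+ 2 <= expR (2 * y ^+ 2) by exact: expR_ge1Dx.
  have : expR y * (1 - y) <= 1.
    rewrite -[leRHS](expRxMexpNx_1 y); apply: ler_wpM2l; first exact: expR_ge0.
    exact: expR_ge1Dx.
  have := expR_ge0 y; set e := expR y => e_ge0 ineq.
  suff : e <= 1 + y + 2 * y ^+ 2 by lra.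
  have y1 : 0 < 1 - y by lra.
  rewrite -(ler_pM2r y1); apply: (le_trans ineq).
  rewrite -subr_ge0 [leRHS](_ : _ = y ^+ 2 * (1 - 2 * y)); last by ring.
  by apply: mulr_ge0; [exact: sqr_ge0|lra].
- have : expR y <= expR (2 * y ^+ 2) by rewrite ler_expR; nra.
  lra.
Qed.

Lemma mgf_three_point (l w1 w2 w3 y1 y2 y3 : R) :
    0 <= w1 -> 0 <= w2 -> 0 <= w3 -> w1 + w2 + w3 = 1 ->
    w1 * y1 + w2 * y2 + w3 * y3 = 0 ->
    y1 ^+ 2 <= 4 -> y2 ^+ 2 <= 4 -> y3 ^+ 2 <= 4 ->
  w1 * expR (l * y1) + w2 * expR (l * y2) + w3 * expR (l * y3)
    <= expR (8 * l ^+ 2).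
Proof.
move=> w1_ge0 w2_ge0 w3_ge0 w_sum w_mean y1_le y2_le y3_le.
have term w y : 0 <= w -> y ^+ 2 <= 4 ->
    w * expR (l * y) <= l * (w * y) + w * expR (8 * l ^+ 2).
  move=> w_ge0 y_le; rewrite mulrCA -mulrDr; apply: ler_wpM2l => //.
  apply: le_trans (expR_le_add_expR_sqr _) _; rewrite lerD2l ler_expR exprMn.
  by have := sqr_ge0 l; nra.
apply: le_trans (lerD (lerD (term _ _ w1_ge0 y1_le) (term _ _ w2_ge0 y2_le))
                      (term _ _ w3_ge0 y3_le)) _.
rewrite [leLHS](_ : _ = l * (w1 * y1 + w2 * y2 + w3 * y3)
                     + (w1 + w2 + w3) * expR (8 * l ^+ 2)); last ring.
by rewrite w_sum w_mean mulr0 add0r mul1r.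
Qed.

End ExponentialBounds.

(** * Sphere sizes and the moment generating function as coefficients *)

Definition sphere_size (m n s : nat) : nat := ('C(n, s) * m ^ s)%N.

Section SphereSize.
Variables (R : realType) (m : nat).
Hypothesis m_gt0 : (0 < m)%N.
Implicit Types n s k : nat.

Let mR_gt0 : 0 < m%:R :> R. Proof. by rewrite ltr0n. Qed.

Lemma sphere_size_small n s : (n < s)%N -> sphere_size m n s = 0%N.
Proof. by move=> lt_ns; rewrite /sphere_size bin_small. Qed.

(** For a uniform point of a sphere of radius s in dimension n + 1, a given
    coordinate equals that of the centre with probability 1 - s / (n + 1).
    The next lemma is the complementary event. *)
Lemma sphere_size_keep n s : (s <= n.+1)%N ->
  (sphere_size m n s)%:R
    = (1 - s%:R / n.+1%:R) * (sphere_size m n.+1 s)%:R :> R.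
Proof.
move=> le_sn; have n_neq0 : n.+1%:R != 0 :> R by rewrite pnatr_eq0.
apply: (mulfI n_neq0); rewrite mulrA mulrBr mulr1 mulrCA divff // mulr1.
by rewrite -natrB // -!natrM /sphere_size !mulnA -mul_bin_down.
Qed.

Lemma sphere_size_change n s :
  m%:R * (sphere_size m n s)%:R
    = s.+1%:R / n.+1%:R * (sphere_size m n.+1 s.+1)%:R :> R.
Proof.
have n_neq0 : n.+1%:R != 0 :> R by rewrite pnatr_eq0.
apply: (mulfI n_neq0); rewrite [RHS]mulrA [X in _ = X * _]mulrCA divff //.
rewrite mulr1 -!natrM /sphere_size expnS [in RHS]mulnA -mul_bin_diag /=.
by congr _%:R; ring.
Qed.

Lemma coef_sphere_poly n s :
  ((1 + m%:R *: 'X) ^+ n : {poly R})`_s = (sphere_size m n s)%:R.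
Proof.
elim: n s => [|n IHn] s.
  by rewrite expr0 coef1 /sphere_size bin0n; case: s => [|s]; rewrite ?mul1n.
rewrite exprS mulrDl mul1r -scalerAl coefD coefZ coefXM !IHn /sphere_size.
case: s => [|s] /=; first by rewrite mulr0 addr0 !bin0.
by rewrite -natrM -natrD binS expnS; congr _%:R; ring.
Qed.

(** The mean of the contribution to ell of one coordinate where a and b differ,
    on a sphere of radius s: the coordinate agrees with a with probability
    1 - s / n and with b with probability s / (n m). *)
Definition drift n s : R := 1 - s%:R / n%:R * (m.+1%:R / m%:R).

(** The factor 1 - 'X carries the contribution of one coordinate: +1 if the
    word agrees with a there, and -1 for the single letter of b, marked by
    'X. *)
Lemma coef_drift n s :
  ((1 - 'X) * (1 + m%:R *: 'X) ^+ n : {poly R})`_s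
    = (sphere_size m n.+1 s)%:R * drift n.+1 s.
Proof.
rewrite mulrBl mul1r coefB coefXM !coef_sphere_poly.
have [lt_ns|le_sn] := ltnP n.+1 s.
  rewrite !sphere_size_small ?mul0r //; last by rewrite ltnW.
    by case: s lt_ns => //= s _; rewrite subrr.
  by case: s lt_ns.
have m_neq0 : m%:R != 0 :> R by rewrite gt_eqF.
have n_neq0 : 1 + n%:R != 0 :> R by rewrite nat1r pnatr_eq0.
rewrite (@sphere_size_keep n s) // /drift -(@natr1 R m).
case: s le_sn => [|s] le_sn /=; first by rewrite !mul0r !subr0 mulrC.
apply: (mulfI m_neq0); rewrite mulrBr sphere_size_change.
by field; rewrite m_neq0.
Qed.

(** The factor of a coordinate where a and b differ: the letter of a has
    weight exp l, the letter of b has weight exp (- l), and the m - 1 others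
    have weight 1. *)
Definition tilted_poly (l : R) : {poly R} :=
  (expR l)%:P + (m%:R - 1 + expR (- l)) *: 'X.

(** One revealed coordinate.  Here t is the probability of leaving a, and b
    measures how strongly the revealed value shifts the drift of the
    coordinates still hidden: their total mean moves by - b t if the
    coordinate agrees with a and by b (1 - t) otherwise.  The shifts keep the
    three-valued variable centred, and since b <= q / m, within [-2, 2]. *)
Lemma mgf_step (l t b : R) : 0 <= t <= 1 -> 0 <= b <= m.+1%:R / m%:R ->
  let mu := 1 - t * (m.+1%:R / m%:R) in
  (1 - t) * expR (l * (1 - mu - b * t))
  + t * ((m%:R - 1) / m%:R) * expR (l * (b * (1 - t) - mu))
  + t / m%:R * expR (l * (b * (1 - t) - mu - 1)) <= expR (8 * l ^+ 2).
Proof.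
move=> /andP[t_ge0 t_le1] /andP[b_ge0]; rewrite -natr1.
have m_ge1 : 1 <= m%:R :> R by rewrite ler1n.
have v_gt0 : 0 < m%:R^-1 :> R by rewrite invr_gt0.
have v_le1 : m%:R^-1 <= 1 :> R by rewrite invf_le1.
have mv : m%:R / m%:R = 1 :> R by rewrite divff // gt_eqF.
rewrite !mulrBl mulrDl mv !mul1r.
move: v_gt0 v_le1; set v := m%:R^-1 => v_gt0 v_le1 b_le /=.
have tb_ge0 : 0 <= t * b by exact: mulr_ge0.
have tb_le : t * b <= t * (1 + v) by exact: ler_wpM2l.
have tv_ge0 : 0 <= t * v by rewrite mulr_ge0 // ltW.
have tv_le : t * v <= v by rewrite ger_pMl.
have sqr_le4 (y : R) : -2 <= y -> y <= 2 -> y ^+ 2 <= 4.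
  move=> y_ge y_le; rewrite -subr_ge0.
  rewrite [leRHS](_ : _ = (2 - y) * (y - -2)); last by ring.
  by apply: mulr_ge0; rewrite subr_ge0.
apply: mgf_three_point; rewrite ?subr_ge0 //.
- by rewrite mulr_ge0 // subr_ge0.
- ring.
- ring.
- apply: sqr_le4; lra.
- apply: sqr_le4; nra.
- apply: sqr_le4; nra.
Qed.

(** The Gaussian bound on the moment generating function, by induction on the
    number k of tilted factors.  Removing one factor in dimension n + 1 leaves
    dimension n, with radius s or s - 1.  The means of the remaining k
    coordinates then differ from k (1 - t q / m), for t = s / (n + 1), by the
    shifts of [mgf_step] with b = (q / m) (k / n). *)
Lemma tilted_coef_le (l : R) k n s : (k <= n)%N ->
  (tilted_poly l ^+ k * (1 + m%:R *: 'X) ^+ (n - k))`_s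
  <= (sphere_size m n s)%:R
     * expR (l * (k%:R * drift n s) + 8 * l ^+ 2 * k%:R).
Proof.
elim: k n s => [|k IHk] [|n] s // le_kn.
- by rewrite expr0 mul1r coef_sphere_poly !(mul0r, mulr0) addr0 expR0 mulr1.
- by rewrite expr0 mul1r coef_sphere_poly !(mul0r, mulr0) addr0 expR0 mulr1.
rewrite exprS -mulrA subSS mulrDl coefD coefCM -scalerAl coefZ coefXM.
set P := (X in expR l * X`_s).
set E := 8 * l ^+ 2 * k%:R; set kappa : R := m.+1%:R / m%:R.
have n1_gt0 : 0 < n.+1%:R :> R by rewrite ltr0n.
have kappa_ge0 : 0 <= kappa by rewrite divr_ge0.
have [lt_ns|le_sn] := ltnP n.+1 s.
  rewrite sphere_size_small // mul0r.
  have zero i : (n < i)%N -> P`_i <= 0.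
    move=> lt_ni; apply: le_trans (IHk n i le_kn) _.
    by rewrite sphere_size_small // mul0r.
  have w_ge0 : 0 <= m%:R - 1 + expR (- l) :> R.
    by rewrite addr_ge0 ?expR_ge0 // subr_ge0 ler1n.
  case: s lt_ns => [|s] //= lt_ns.
  apply: (@le_trans _ _ (0 + 0)); last by rewrite addr0.
  apply: lerD; rewrite mulr_ge0_le0 ?expR_ge0 //; apply: zero => //.
  exact: ltnW.
set t : R := s%:R / n.+1%:R.
have t01 : 0 <= t <= 1.
  by rewrite divr_ge0 //= ler_pdivrMr // mul1r ler_nat.
pose b : R := kappa * (k%:R / n%:R).
have kn01 : 0 <= (k%:R / n%:R : R) <= 1.
  rewrite divr_ge0 //=; case: (posnP n) => [->|n_gt0].
    by rewrite invr0 mulr0.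
  by rewrite ler_pdivrMr ?ltr0n // mul1r ler_nat.
have b01 : 0 <= b <= kappa.
  by case/andP: kn01 => ? ?; rewrite mulr_ge0 //= ler_piMr.
pose mu : R := 1 - t * kappa.
(* For n = 0 the quotient k / n is 0 / 0 = 0, and k = 0. *)
have kn_eq : k%:R / n%:R * n%:R = k%:R :> R.
  case: (posnP n) le_kn => [->|n_gt0 _]; last first.
    by rewrite divfK // pnatr_eq0 -lt0n.
  by rewrite ltnS leqn0 => /eqP->; rewrite mulr0.
have kdrift i : k%:R * drift n i = k%:R - k%:R / n%:R * i%:R * kappa.
  by rewrite /drift -/kappa; ring.
have tn_eq : t * (n%:R + 1) = s%:R by rewrite natr1 divfK // gt_eqF.
have keep_mean : k%:R * drift n s = k%:R * mu - b * t.
  by rewrite kdrift -tn_eq /mu /b -{1 3}kn_eq; ring.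
set Z : R := (sphere_size m n.+1 s)%:R.
pose common : R := Z * expR (l * (k.+1%:R * mu) + E).
have keep_le : expR l * P`_s
    <= common * ((1 - t) * expR (l * (1 - mu - b * t))).
  apply: (@le_trans _ _ (expR l * ((sphere_size m n s)%:R *
      expR (l * (k%:R * drift n s) + E)))).
    by rewrite ler_pM2l ?expR_gt0 //; apply: IHk.
  rewrite sphere_size_keep // -/t -/Z keep_mean /common.
  rewrite [leLHS](_ : _ = Z * (1 - t) *
      (expR l * expR (l * (k%:R * mu - b * t) + E))); last by ring.
  rewrite [leRHS](_ : _ = Z * (1 - t) *
      (expR (l * (k.+1%:R * mu) + E) * expR (l * (1 - mu - b * t))));
    last by ring.
  rewrite -!expRD -natr1 (_ : l + _ = l * ((k%:R + 1) * mu) + E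
     + l * (1 - mu - b * t)) //; ring.
have change_le :
    (m%:R - 1 + expR (- l)) * (if s == 0%N then 0 else P`_s.-1)
    <= common * (t * ((m%:R - 1) / m%:R) * expR (l * (b * (1 - t) - mu))
                 + t / m%:R * expR (l * (b * (1 - t) - mu - 1))).
  have m1_ge0 : 0 <= m%:R - 1 :> R by rewrite subr_ge0 ler1n.
  case/andP: t01 => t_ge0 _.
  have [s0|s_neq0] := eqVneq s 0%N.
    rewrite mulr0; apply: mulr_ge0.
      by rewrite mulr_ge0 // expR_ge0.
    by rewrite addr_ge0 // !mulr_ge0 ?expR_ge0 ?invr_ge0.
  have s_eq : s.-1%:R = t * (n%:R + 1) - 1.
    by rewrite tn_eq -[in RHS](prednK (n := s)) ?lt0n // -natr1 addrK.
  have change_mean : k%:R * drift n s.-1 = k%:R * mu + b * (1 - t).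
    by rewrite kdrift s_eq /mu /b -{1 3}kn_eq; ring.
  have size_eq : (sphere_size m n s.-1)%:R = t / m%:R * Z.
    have := sphere_size_change n s.-1.
    rewrite prednK ?lt0n // -/t -/Z => eq_change.
    by rewrite mulrAC -eq_change mulrAC divff ?mul1r // gt_eqF.
  apply: (@le_trans _ _ ((m%:R - 1 + expR (- l)) *
     ((sphere_size m n s.-1)%:R * expR (l * (k%:R * drift n s.-1) + E)))).
    by apply: ler_wpM2l; [rewrite addr_ge0 ?expR_ge0 | exact: IHk].
  rewrite size_eq change_mean /common.
  rewrite [l * (_ - mu - 1)](_ : _ = l * (b * (1 - t) - mu) - l); last by ring.
  rewrite [l * (k%:R * mu + _) + E](_ : _ = l * (k.+1%:R * mu) + E
     + l * (b * (1 - t) - mu)); last by rewrite -natr1; ring.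
  rewrite !expRD le_eqVlt; apply/orP; left; apply/eqP; ring.
apply: le_trans (lerD keep_le change_le) _.
rewrite -mulrDr addrA.
apply: le_trans (ler_wpM2l _ (mgf_step l t01 b01)) _.
  by rewrite mulr_ge0 // expR_ge0.
rewrite /common -[leLHS]mulrA -expRD.
rewrite [drift _ _](_ : _ = mu) //.
rewrite [_ + _ + _ in leLHS](_ : _ =
  l * (k.+1%:R * mu) + 8 * l ^+ 2 * k.+1%:R) //.
rewrite /E -natr1; ring.
Qed.

End SphereSize.

(** * Sums over Hamming spheres *)

Section HammingSpheres.
Variables (R : realType) (m n : nat).
Hypothesis m_gt0 : (0 < m)%N.

Local Notation letter := 'I_m.+1.
Local Notation X := (word m.+1 n).
Local Notation d := (@hamming m.+1 n).
Implicit Types (a b x : X) (s k : nat) (l t : R).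

(** Spheres of natural radius, on which coefficients of polynomials are read
    off; the nonempty spheres of real radius pn - i are of this form. *)
Definition nsphere a s : {set X} := [set x | d x a == s].

Lemma hamming_sum a b : d a b = (\sum_j (a j != b j))%N.
Proof.
rewrite /hamming -sum1_card big_mkcond; apply: eq_bigr => j _.
by rewrite inE; case: (_ != _).
Qed.

Lemma hamming_le a b : (d a b <= n)%N.
Proof. by rewrite /hamming -[leqRHS]card_ord max_card. Qed.

(** Expanding the product of sums over all words collects the factors 'X of
    the coordinates where x and a differ into 'X^(d x a). *)
Lemma sum_nsphere_prod (w : 'I_n -> letter -> R) a s :
  \sum_(x in nsphere a s) \prod_j w j (x j)
    = (\prod_j \sum_c w j c *: 'X^(c != a j))`_s.
Proof.
rewrite (@bigA_distr_bigA _ 0 1 *%R +%R) /= coef_sum big_mkcond /=.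
apply: eq_bigr => x _; rewrite scaler_prod prodrXr -hamming_sum coefZ coefXn.
by rewrite inE eq_sym; case: eqP => _; rewrite ?mulr1 ?mulr0.
Qed.

(** The contribution of one coordinate to ell. *)
Definition gain (a0 b0 c : letter) : R := (c != b0)%:R - (c != a0)%:R.

Lemma ell_sum a b x : ell R d a b x = \sum_j gain (a j) (b j) (x j).
Proof. by rewrite /ell !hamming_sum !natr_sum sumrB. Qed.

Lemma sum_letters (f : R -> R) (a0 b0 : letter) :
  \sum_c f (gain a0 b0 c) *: 'X^(c != a0)
    = if a0 == b0 then f 0 *: (1 + m%:R *: 'X)
      else (f 1)%:P + (f 0 * (m%:R - 1) + f (-1)) *: 'X :> {poly R}.
Proof.
have sum_others (v : {poly R}) : \sum_(c | c != a0) v = m%:R *: v.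
  rewrite (eq_bigl (mem (predC1 a0))) ?sumr_const; last first.
    by move=> c; rewrite !inE.
  by rewrite cardC1 card_ord scaler_nat.
rewrite (bigD1 a0) //= eqxx expr0 /gain eqxx.
have [<-|neq_ab] := eqVneq a0 b0.
  rewrite subrr scalerDr; congr (_ + _).
  rewrite scalerA mulrC -scalerA -sum_others; apply: eq_bigr => c /negbTE c_neq.
  by rewrite c_neq subrr.
rewrite subr0 alg_polyC; congr (_ + _).
have b_neq : b0 != a0 by rewrite eq_sym.
have := sum_others (f 0 *: 'X); rewrite (bigD1 b0) //= => others.
rewrite (bigD1 b0) //= b_neq eqxx /= sub0r expr1.
rewrite (eq_bigr (fun=> f 0 *: 'X)) => [|c /andP[-> ->]]; last by rewrite subrr.
move/(canRL (addKr _)): others => ->.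
rewrite mulrBr mulr1 !scalerDl scalerA scaleNr addrC [m%:R * _]mulrC.
by rewrite [- _ + _]addrC.
Qed.

Lemma card_nsphere a s : #|nsphere a s|%:R = (sphere_size m n s)%:R :> R.
Proof.
rewrite -sum1_card natr_sum.
transitivity (\sum_(x in nsphere a s) \prod_(j < n) (1 : R)).
  by apply: eq_bigr => x _; rewrite big1.
rewrite (sum_nsphere_prod (fun _ _ => 1)) -coef_sphere_poly.
rewrite (eq_bigr (fun=> 1 + m%:R *: 'X)) ?prodr_const ?card_ord // => j _.
by rewrite (sum_letters (fun=> 1) (a j) (a j)) eqxx scale1r.
Qed.

Lemma nsphere_mgf a b s l :
  \sum_(x in nsphere a s) expR (l * ell R d a b x)
    = (tilted_poly m l ^+ d a b * (1 + m%:R *: 'X) ^+ (n - d a b))`_s.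
Proof.
transitivity (\sum_(x in nsphere a s)
    \prod_j expR (l * gain (a j) (b j) (x j))).
  by apply: eq_bigr => x _; rewrite ell_sum mulr_sumr expR_sum.
rewrite (sum_nsphere_prod (fun j c => expR (l * gain (a j) (b j) c))).
congr ((polyseq _)`_s).
rewrite (eq_bigr (fun j => if a j != b j then tilted_poly m l
                           else 1 + m%:R *: 'X)); last first.
  move=> j _; rewrite (sum_letters (fun v => expR (l * v))) if_neg.
  by rewrite mulr0 expR0 scale1r mul1r mulr1 mulrN1.
have cardD : #|[set j | a j != b j]| = d a b by [].
rewrite (bigID (fun j => a j != b j)) /=; congr (_ * _).
  rewrite (eq_bigr (fun=> tilted_poly m l)) => [|j -> //].
  rewrite (eq_bigl (mem [set j | a j != b j])) => [|j]; last by rewrite !inE.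
  by rewrite prodr_const cardD.
rewrite (eq_bigr (fun=> 1 + m%:R *: 'X)) => [|j /negbTE -> //].
rewrite (eq_bigl (mem (~: [set j | a j != b j]))) => [|j]; last by rewrite !inE.
by rewrite prodr_const cardsCs setCK card_ord cardD.
Qed.

Lemma sum_nsphere_gain a b s j :
  \sum_(x in nsphere a s) gain (a j) (b j) (x j)
    = (a j != b j)%:R * ((sphere_size m n s)%:R * drift R m n s).
Proof.
(* Weight 1 on the other coordinates makes a single gain a product. *)
transitivity (\sum_(x in nsphere a s)
    \prod_i (if i == j then gain (a i) (b i) (x i) else 1)).
  apply: eq_bigr => x _; rewrite (bigD1 j) //= eqxx big1 ?mulr1 //.
  by move=> i /negbTE->.
rewrite (sum_nsphere_prod
  (fun i c => if i == j then gain (a i) (b i) c else 1)) (bigD1 j) //= eqxx.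
rewrite (sum_letters id).
rewrite (eq_bigr (fun=> 1 + m%:R *: 'X)) => [|i /negbTE->]; last first.
  by rewrite (sum_letters (fun=> 1) (a i) (a i)) eqxx scale1r.
rewrite (eq_bigl (mem (predC1 j))) => [|i]; last by rewrite !inE.
rewrite prodr_const cardC1 card_ord.
case: eqP => _; first by rewrite scale0r !mul0r coef0.
have n_eq : n = n.-1.+1 by case: (n) j => [[]|].
rewrite !mul0r add0r mul1r scaleN1r [in RHS]n_eq -coef_drift //.
Qed.

Lemma sum_nsphere_ell a b s :
  \sum_(x in nsphere a s) ell R d a b x
    = (sphere_size m n s)%:R * ((d a b)%:R * drift R m n s).
Proof.
transitivity (\sum_(x in nsphere a s) \sum_j gain (a j) (b j) (x j)).
  by apply: eq_bigr => x _; exact: ell_sum.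
rewrite exchange_big /= (eq_bigr _ (fun j _ => sum_nsphere_gain a b s j)).
by rewrite -mulr_suml -natr_sum -hamming_sum mulrCA.
Qed.

Lemma nsphere_mgf_centered a b s l :
  \sum_(x in nsphere a s)
     expR (l * (ell R d a b x - (d a b)%:R * drift R m n s))
  <= (sphere_size m n s)%:R * expR (8 * l ^+ 2 * (d a b)%:R).
Proof.
set mean := _ * drift R m n s.
have := tilted_coef_le m_gt0 l s (hamming_le a b); rewrite -nsphere_mgf -/mean.
set sum1 := (X in X <= _) => sum1_le.
rewrite (_ : \sum_(x in _) _ = sum1 * expR (- (l * mean))); last first.
  by rewrite mulr_suml; apply: eq_bigr => x _; rewrite mulrBr expRD.
apply: le_trans (ler_wpM2r (expR_ge0 _) sum1_le) _.
by rewrite -[leLHS]mulrA -expRD addrAC subrr add0r.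
Qed.

(** Markov's inequality for exp Y, in counting form. *)
Lemma card_markov (T : finType) (A : {set T}) (Y : T -> R) (u : R) :
  #|[set x in A | u <= Y x]|%:R * expR u <= \sum_(x in A) expR (Y x).
Proof.
rewrite -sum1_card natr_sum mulr_suml big_mkcond [leRHS]big_mkcond /=.
apply: ler_sum => x _; rewrite !inE; case: (x \in A) => //=.
by case: ifP => [u_le|_]; rewrite ?expR_ge0 // mul1r ler_expR.
Qed.

(** Chernoff bound at the optimal l = t / (16 k); the sign sg covers both
    tails. *)
Lemma nsphere_tail a b s (sg t : R) : sg ^+ 2 = 1 -> 0 <= t -> (0 < d a b)%N ->
  #|[set x in nsphere a s |
       t <= sg * (ell R d a b x - (d a b)%:R * drift R m n s)]|%:R
  <= #|nsphere a s|%:R * expR (- (t ^+ 2 / (32 * (d a b)%:R))).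
Proof.
move=> sg_sqr t_ge0 k_gt0; set k : R := (d a b)%:R.
have kR_gt0 : 0 < k by rewrite ltr0n.
pose l := t / (16 * k).
have l_ge0 : 0 <= l by rewrite divr_ge0 // mulr_ge0 // ltW.
have exponent : 8 * (l * sg) ^+ 2 * k - l * t = - (t ^+ 2 / (32 * k)).
  by rewrite exprMn sg_sqr /l; field; rewrite gt_eqF.
rewrite -exponent expRD mulrA expRN ler_pdivlMr ?expR_gt0 //.
rewrite card_nsphere.
apply: le_trans (nsphere_mgf_centered a b s (l * sg)); rewrite -/k.
under [leRHS]eq_bigr do rewrite -mulrA.
apply: le_trans (card_markov _ _ _); apply: ler_wpM2r; first exact: expR_ge0.
rewrite ler_nat subset_leq_card //; apply/subsetP => x; rewrite !inE.
by move=> /andP[-> t_le] /=; apply: ler_wpM2l.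
Qed.

End HammingSpheres.

(** * Growth and intersection of Hamming balls *)

Lemma card_by_level (T : finType) (A : {set T}) (f : T -> nat) r :
    {in A, forall x, f x <= r}%N ->
  #|A| = (\sum_(s < r.+1) #|[set x in A | f x == s]|)%N.
Proof.
move=> f_le; rewrite -sum1_card.
rewrite (partition_big (fun x => inord (f x) : 'I_r.+1) xpredT) //=.
apply: eq_bigr => s _; rewrite -sum1_card; apply: eq_bigl => x; rewrite !inE.
have [x_in|//] := boolP (x \in A).
by rewrite /= -val_eqE /= inordK // ltnS f_le.
Qed.

Section HammingBalls.
Variables (R : realType) (m n : nat).
Hypothesis m_gt0 : (0 < m)%N.

Local Notation X := (word m.+1 n).
Local Notation d := (@hamming m.+1 n).
Implicit Types (a b x : X) (r s t : nat).

Definition nball a r : {set X} := [set x | d x a <= r]%N.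

Lemma card_nball a r :
  #|nball a r|%:R = \sum_(s < r.+1) (sphere_size m n s)%:R :> R.
Proof.
rewrite (@card_by_level _ _ (fun x => d x a) r) => [|x]; last by rewrite inE.
rewrite natr_sum; apply: eq_bigr => s _; rewrite -(card_nsphere R a).
congr _%:R; apply: eq_card => x; rewrite !inE; apply: andb_idl => /eqP->.
by rewrite -ltnS.
Qed.

Lemma card_nball_gt0 a r : (0 < #|nball a r|)%N.
Proof.
apply/card_gt0P; exists a; rewrite inE.
rewrite (_ : d a a = 0%N) //; apply/eqP; rewrite cards_eq0; apply/eqP/setP => j.
by rewrite !inE eqxx.
Qed.

Section Radius.
Variables (p : R) (r : nat).
Hypotheses (n_gt0 : (0 < n)%N) (p_gt0 : 0 < p) (p_lt : p * m.+1%:R < m%:R).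
Hypothesis r_def : p * n%:R = r%:R.

(** This is pn / ((n - pn) m), which dominates the ratio (s + 1) / ((n - s) m)
    of consecutive sphere sizes as long as s + 1 <= pn. *)
Definition growth_ratio : R := p / ((1 - p) * m%:R).

Let mR_gt0 : 0 < m%:R :> R. Proof. by rewrite ltr0n. Qed.

Let p_lt1 : p < 1.
Proof. by move: p_lt mR_gt0; rewrite -natr1; nra. Qed.

Let den_gt0 : 0 < (1 - p) * m%:R.
Proof. by rewrite mulr_gt0 // subr_gt0. Qed.

Lemma growth_ratio_gt0 : 0 < growth_ratio.
Proof. exact: divr_gt0. Qed.

Lemma growth_ratio_lt1 : growth_ratio < 1.
Proof. by move: p_lt; rewrite ltr_pdivrMr // -natr1; lra. Qed.

Lemma radius_le : (r <= n)%N.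
Proof.
by rewrite -(ler_nat R) -r_def ger_pMl ?ltr0n // ltW.
Qed.

Lemma sphere_size_ratio s : (s < r)%N ->
  (sphere_size m n s)%:R <= growth_ratio * (sphere_size m n s.+1)%:R :> R.
Proof.
move=> lt_sr.
have lt_sn : (s < n)%N by exact: leq_trans lt_sr radius_le.
have rec : s.+1%:R * (sphere_size m n s.+1)%:R
    = (n - s)%:R * m%:R * (sphere_size m n s)%:R :> R.
  by rewrite -!natrM /sphere_size mulnA mul_bin_left expnS; congr _%:R; ring.
have s1_gt0 : 0 < s.+1%:R :> R by rewrite ltr0n.
rewrite /growth_ratio mulrAC ler_pdivlMr // -(ler_pM2l s1_gt0).
rewrite [leRHS]mulrCA rec mulrCA mulrC [leRHS]mulrA.
rewrite ler_wpM2r //.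
have s1_le : s.+1%:R <= p * n%:R by rewrite r_def ler_nat.
have ns_ge : (1 - p) * n%:R <= (n - s)%:R.
  by rewrite natrB 1?ltnW //; move: s1_le; rewrite -natr1; lra.
rewrite [leLHS]mulrCA !mulrA ler_pM2r //.
apply: (@le_trans _ _ ((1 - p) * (p * n%:R))).
  by rewrite ler_pM2l // subr_gt0.
by rewrite mulrCA ler_pM2l.
Qed.

Lemma nball_growth a t : (t <= r)%N ->
  #|nball a (r - t)|%:R <= growth_ratio ^+ t * #|nball a r|%:R.
Proof.
move=> le_tr; rewrite !card_nball.
have ratio_ge0 := ltW growth_ratio_gt0.
have shift i s : (s + i <= r)%N ->
    (sphere_size m n s)%:R <= growth_ratio ^+ i * (sphere_size m n (s + i))%:R.
  elim: i s => [|i IHi] s le_sr; first by rewrite expr0 mul1r addn0.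
  rewrite addnS in le_sr *.
  apply: (le_trans (IHi s (ltnW le_sr))).
  by rewrite exprSr -mulrA ler_wpM2l ?exprn_ge0 // sphere_size_ratio.
rewrite -[r in leRHS](subnK le_tr) -addSn addnC.
rewrite [in leRHS]big_split_ord /= mulrDr -[leLHS]add0r.
apply: lerD; first by rewrite mulr_ge0 ?exprn_ge0 // sumr_ge0.
rewrite mulr_sumr; apply: ler_sum => s _; rewrite addnC shift //.
by have := ltn_ord s; lia.
Qed.

Lemma drift_radius_le s : (s <= r)%N ->
  1 - p * m.+1%:R / m%:R <= drift R m n s.
Proof.
move=> le_sr; rewrite /drift lerD2l lerN2 -[leRHS]mulrA ler_wpM2r ?divr_ge0 //.
by rewrite ler_pdivrMr ?ltr0n // r_def ler_nat.
Qed.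

(** The points of both balls split into the deep ones, at depth at least t in
    the ball around a, and the shallow ones.  A shallow point at depth
    i <= alpha k has d x b <= r, hence ell <= i <= alpha k, while the mean of
    ell on its sphere is at least 2 alpha k: it lies in a lower tail. *)
Lemma nball_inter_le a b (alpha : R) :
    alpha = 1 / 2 * (1 - p * m.+1%:R / m%:R) -> (0 < d a b)%N ->
  let t := (Num.truncn (alpha * (d a b)%:R)).+1 in
  #|nball a r :&: nball b r|%:R
  <= (growth_ratio ^+ t + expR (- (alpha ^+ 2 / 32 * (d a b)%:R)))
     * #|nball a r|%:R.
Proof.
move=> alpha_def k_gt0; set k := d a b; set t := (_).+1 => /=.
have k_gt0R : 0 < k%:R :> R by rewrite ltr0n.
have alpha_ge0 : 0 <= alpha.
  rewrite alpha_def mulr_ge0 ?divr_ge0 // subr_ge0 ler_pdivrMr // mul1r.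
  exact: ltW.
have ak_ge0 : 0 <= alpha * k%:R by rewrite mulr_ge0.
have lt_t i : (i < t)%N -> i%:R <= alpha * k%:R by rewrite ltnS truncn_ge_nat.
clearbody t.
pose deep := [set x | d x a + t <= r]%N.
pose shallow := (nball a r :&: nball b r) :\: deep.
have cover : nball a r :&: nball b r \subset deep :|: shallow.
  by apply/subsetP => x x_in; rewrite inE [in X in _ || X]inE x_in andbT orbN.
have deep_le : #|deep|%:R <= growth_ratio ^+ t * #|nball a r|%:R.
  have [le_tr|lt_rt] := leqP t r.
    apply: le_trans (nball_growth a le_tr); rewrite ler_nat subset_leq_card //.
    by apply/subsetP => x; rewrite !inE; lia.
  rewrite (_ : deep = set0) ?cards0.
    by rewrite mulr_ge0 // exprn_ge0 // ltW // growth_ratio_gt0.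
  by apply/setP => x; rewrite !inE; apply/negP; lia.
have shallow_le : #|shallow|%:R
    <= expR (- (alpha ^+ 2 / 32 * k%:R)) * #|nball a r|%:R.
  rewrite (@card_by_level _ shallow (fun x => d x a) r) => [|x]; last first.
    by rewrite !inE => /and3P[].
  rewrite card_nball mulr_sumr natr_sum; apply: ler_sum => s _.
  have sqrN1 : (-1 : R) ^+ 2 = 1 by rewrite sqrrN expr1n.
  have tail := @nsphere_tail R m n m_gt0 a b s _ _ sqrN1 ak_ge0 k_gt0.
  have exponent : alpha ^+ 2 / 32 * k%:R = (alpha * k%:R) ^+ 2 / (32 * k%:R).
    by field; rewrite gt_eqF.
  rewrite exponent mulrC -(card_nsphere R a); apply: le_trans tail.
  rewrite ler_nat subset_leq_card //; apply/subsetP => x.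
  rewrite !inE -ltnNge => /andP[/and3P[lt_rt _ le_b] /eqP xa_eq].
  rewrite xa_eq eqxx /= mulN1r opprB /ell xa_eq.
  have le_sr : (s <= r)%N by rewrite -ltnS.
  have mean_ge : 2 * (alpha * k%:R) <= k%:R * drift R m n s.
    rewrite mulrA mulrC ler_wpM2l //; apply: le_trans (drift_radius_le le_sr).
    by rewrite alpha_def; lra.
  have : (r - s)%:R <= alpha * k%:R.
    by apply: lt_t; move: lt_rt; rewrite xa_eq; lia.
  have : (d x b)%:R <= r%:R :> R by rewrite ler_nat.
  rewrite natrB //; lra.
rewrite mulrDl; apply: le_trans (lerD deep_le shallow_le).
rewrite -natrD ler_nat; apply: leq_trans (subset_leq_card cover) _.
exact: leq_card_setU.
Qed.

End Radius.
End HammingBalls.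

(** * The theorem *)

Theorem lemma4p2 (R : realType) (q : nat) (p : R)
    (q_ge2 : (2 <= q)%N) (p_gt0 : 0 < p) (p_lt : p < (q%:R - 1) / q%:R) :
  let alpha : R := 1 / 2 * (1 - p * q%:R / (q%:R - 1)) in
  exists c c' : R, 0 < c /\ 0 < c' /\
  forall n k : nat, (0 < n)%N -> p * n%:R \is a Num.int -> (0 < k)%N ->
    let d := @hamming q n in
    exp_growth d (p * n%:R) c /\
    (0 < alpha /\ dispersed d (p * n%:R) k alpha) /\
    (forall a b : word q n, d a b = k ->
     forall i : nat, i%:R <= alpha * k%:R ->
     let S := msphere d a (p * n%:R - i%:R) in
     S != set0 ->
     usubgaussian S (fun x => ell R d a b x - uexp S (ell R d a b))
       (400 * k%:R)) /\
    (forall a b : word q n,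
     #|mball d a (p * n%:R) :&: mball d b (p * n%:R)|%:R
       / #|mball d a (p * n%:R)|%:R
     <= 2 * expR (- (c' * (d a b)%:R))).
Proof.
case: q q_ge2 p_lt => [//|m] m_gt0; rewrite ltnS in m_gt0.
have mR_gt0 : 0 < m%:R :> R by rewrite ltr0n.
rewrite (_ : m.+1%:R - 1 = m%:R); last by rewrite -natr1 addrK.
rewrite ltr_pdivlMr ?ltr0n // => p_lt alpha.
have alpha_gt0 : 0 < alpha.
  by rewrite mulr_gt0 ?divr_gt0 // subr_gt0 ltr_pdivrMr // mul1r.
pose rho : R := growth_ratio m p.
have rho_gt0 : 0 < rho := growth_ratio_gt0 m_gt0 p_gt0 p_lt.
have rho_lt1 : rho < 1 := growth_ratio_lt1 m_gt0 p_lt.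
pose c : R := - ln rho.
have c_gt0 : 0 < c by rewrite oppr_gt0 ln_lt0 // rho_gt0.
have rhoX t : rho ^+ t = expR (- (c * t%:R)).
  by rewrite mulNr opprK expRM_natr lnK.
pose c' : R := Num.min (c * alpha) (alpha ^+ 2 / 32).
exists c, c'; split=> //; split.
  by rewrite lt_min mulr_gt0 // divr_gt0 ?exprn_gt0.
move=> n k n_gt0 pn_int k_gt0 d.
have [r r_def] : exists r, p * n%:R = r%:R.
  by apply/natrP; rewrite natrEint pn_int mulr_ge0 // ltW.
rewrite r_def.
have mballE a s : mball d a s%:R = nball a s.
  by apply/setP => x; rewrite !inE ler_nat.
have msphereE a (i : nat) : msphere d a (r%:R - i%:R : R) != set0 ->
    msphere d a (r%:R - i%:R : R) = nsphere a (r - i).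
  case/set0Pn => x; rewrite inE => /eqP xa_eq.
  have le_ir : (i <= r)%N by rewrite -(ler_nat R) -subr_ge0 -xa_eq.
  by apply/setP => y; rewrite !inE -natrB // eqr_nat.
have uexpE a b s : nsphere a s != set0 ->
    uexp (nsphere a s) (ell R d a b) = (d a b)%:R * drift R m n s.
  move=> S_neq0; rewrite /uexp sum_nsphere_ell // -(card_nsphere R a).
  by rewrite mulrAC divff ?mul1r // pnatr_eq0 cards_eq0.
split; [|split; [split=> // |split]].
- move=> a t; rewrite ltr_nat => /ltnW le_tr.
  rewrite -natrB // !mballE -rhoX -mulrA.
  have := @nball_growth R m n m_gt0 p r n_gt0 p_gt0 p_lt r_def a t le_tr.
  move/le_trans; apply; rewrite ler_peMl // ?ler1n // mulr_ge0 //.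
  by rewrite exprn_ge0 // ltW.
- move=> a b ab_k i _ S_neq0.
  have S_eq := msphereE _ _ S_neq0; rewrite {}S_eq in S_neq0 *.
  rewrite uexpE // ab_k mulrC.
  rewrite ler_wpM2l //.
  apply: le_trans (drift_radius_le _ n_gt0 r_def (leq_subr i r)) => //.
  by rewrite /alpha; lra.
- move=> a b ab_k i _ /= S_neq0 u u_ge0.
  have S_eq := msphereE _ _ S_neq0; rewrite {}S_eq in S_neq0 *.
  rewrite uexpE //.
  set S := nsphere a _; set mean := _ * drift R m n _.
  have cardS_gt0 : 0 < #|S|%:R :> R by rewrite ltr0n card_gt0.
  rewrite ler_pdivrMr //.
  have k_gt0' : (0 < d a b)%N by rewrite ab_k.
  have up := @nsphere_tail R m n m_gt0 a b (r - i) 1 u (expr1n _ _) u_ge0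
    k_gt0'.
  have sqrN1 : (-1 : R) ^+ 2 = 1 by rewrite sqrrN expr1n.
  have down := @nsphere_tail R m n m_gt0 a b (r - i) (-1) u sqrN1 u_ge0 k_gt0'.
  set e : R := expR (- (u ^+ 2 / (32 * (d a b)%:R))) in up down.
  have e_le : e <= expR (- (u ^+ 2 / (400 * k%:R))).
    rewrite /e ab_k ler_expR lerN2 ler_wpM2l ?sqr_ge0 // lef_pV2.
    - by rewrite ler_pM2r ?ltr0n // ler_nat.
    - by rewrite posrE mulr_gt0 ?ltr0n.
    - by rewrite posrE mulr_gt0 ?ltr0n.
  apply: (@le_trans _ _ (2 * e * #|S|%:R)); last first.
    by rewrite ler_pM2r // ler_pM2l.
  rewrite [leRHS](_ : _ = #|S|%:R * e + #|S|%:R * e); last by ring.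
  apply: le_trans (lerD up down); rewrite -natrD ler_nat.
  apply: leq_trans (leq_card_setU _ _); apply: subset_leq_card.
  apply/subsetP => x; rewrite !inE => /andP[-> ] /=.
  by rewrite mul1r mulN1r -ler_normr.
- move=> a b; rewrite !mballE.
  have cardB_gt0 : 0 < #|nball a r|%:R :> R by rewrite ltr0n card_nball_gt0.
  rewrite ler_pdivrMr //.
  have [ab0|ab_gt0] := posnP (d a b).
    rewrite ab0 mulr0 oppr0 expR0 mulr1.
    apply: (@le_trans _ _ #|nball a r|%:R); last by rewrite ler_peMl // ler1n.
    by rewrite ler_nat subset_leq_card // subsetIl.
  have := @nball_inter_le R m n m_gt0 p r n_gt0 p_gt0 p_lt r_def a b alpha
    erefl ab_gt0.
  move/le_trans; apply; rewrite ler_pM2r // mulr2n [leRHS]mulrDl !mul1r.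
  have c'_le : c' <= c * alpha /\ c' <= alpha ^+ 2 / 32.
    by rewrite !ge_min !lexx orbT.
  apply: lerD; last by rewrite ler_expR lerN2 ler_wpM2r //; case: c'_le.
  rewrite -/rho rhoX ler_expR lerN2.
  apply: (@le_trans _ _ (c * alpha * (d a b)%:R)).
    by rewrite ler_wpM2r //; case: c'_le.
  by rewrite -mulrA ler_pM2l // ltW // truncnS_gt.
Qed.
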